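(* Let $G=(V,E)$ be a finite undirected graph with $n=|V|$, let $d:E\to\mathbb{R}^+$, let $k,\alpha\ge 2$ be integers, and put $\beta=n-(k-1)\alpha$. The inequality $$\sum_{c\in[k]}\ \sum_{\{i,j\}\in E}x_{ij}^c\ \ge\ n-k$$ is valid for the model $(\mathcal{M}_1)$, and $$\sum_{\{i,j\}\in E}x_{ij}\ \ge\ n-k$$ is valid for the model $(\mathcal{M}_2)$.
   Context: Notation: $V=\{1,\dots,n\}$, $[k]=\{1,\dots,k\}$, $\bar E=\{\{i,j\}\notin E: i,j\in V, i\ne j\}$. An (in)equality is valid for a model if every feasible solution of the model satisfies it. Each edge $\{i,j\}$ has two associated antiparallel arcs $(i,j)$, $(j,i)$; $\delta^-_j$ and $\delta^+_j$ are the sets of arcs entering and leaving node $j$. Variables indexed by edges are symmetric ($x_{ij}=x_{ji}$); flow variables are indexed by arcs. Both models describe partitions of $V$ into $k$ sets $V_1,\dots,V_k$ (with $y_i^c=1$ iff $i\in V_c$), each inducing a connected subgraph and having at least $\alpha$ nodes, minimizing the total cost of edges with both ends in the same set. Model $(\mathcal{M}_1)$: variables $y_i^c\in\{0,1\}$ ($i\in V,c\in[k]$), $x_{ij}^c\in\{0,1\}$ ($\{i,j\}\in E,c\in[k]$), $\bar x_{ij}^c\in\{0,1\}$ ($\{i,j\}\in\bar E,c\in[k]$), and $f_{ij}^{lc}\ge 0$ real for both arcs $(i,j)$ of each edge of $E$, $l\in V$, $c\in[k]$. Minimize $\sum_{c\in[k]}\sum_{\{i,j\}\in E}d_{ij}x_{ij}^c$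 subject to: (1) $\sum_{c\in[k]}y_i^c=1$ for all $i\in V$; (2) $y_i^c+y_j^c-x_{ij}^c\le1$ and $y_i^c+y_j^c-2x_{ij}^c\ge0$ for all $\{i,j\}\in E$, $c\in[k]$; (3) $y_i^c+y_j^c-\bar x_{ij}^c\le1$ and $y_i^c+y_j^c-2\bar x_{ij}^c\ge0$ for all $\{i,j\}\in\bar E$, $c\in[k]$; (4) $\sum_{l\in V}(f_{ij}^{lc}+f_{ji}^{lc})\le 2nk\,x_{ij}^c$ for all $\{i,j\}\in E$, $c\in[k]$; (5) for all $(l,j)\in V\times V$, $c\in[k]$: $\sum_{(i,j)\in\delta^-_j}f_{ij}^{lc}-\sum_{(j,i)\in\delta^+_j}f_{ji}^{lc}$ equals $-\sum_{i:\{j,i\}\in\bar E}\bar x_{ji}^c$ if $j=l$, equals $0$ if $\{l,j\}\in E$, and equals $\bar x_{lj}^c$ otherwise; (6) $\sum_{i\in V}y_i^c\ge\alpha$ for all $c\in[k]$. Model $(\mathcal{M}_2)$: let $\mathbb{A}=\{n+1,\dots,n+k\}$ be artificial nodes and $E^k=E\cup\{\{i,j\}:i\in V,j\in\mathbb{A}\}$; arcs and the sets $\delta^\pm_j$ refer to the graph $(V\cup\mathbb{A},E^k)$. Variables $y_i^c\in\{0,1\}$ ($i\in V,c\in[k]$), $x_{ij}\in\{0,1\}$ ($\{i,j\}\in E^k$), and $f_{ij}\ge0$ real for both arcs of each edge of $E^k$. Minimize $\sum_{\{i,j\}\in E}d_{ij}x_{ij}$ subject to: (1) $\sum_{c\in[k]}y_i^c=1$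 for all $i\in V$; (2) $y_i^c+y_j^c-x_{ij}\le1$ for all $\{i,j\}\in E$, $c\in[k]$; (3) $y_i^c+y_j^\ell+x_{ij}\le2$ for all $\{i,j\}\in E$, $c,\ell\in[k]$, $c\ne\ell$; (4) $\sum_{j\in V}x_{ij}=1$ and $\sum_{j\in V}f_{ij}=\sum_{j\in V}y_j^{i-n}$ for all $i\in\mathbb{A}$; (5) $\sum_{(i,j)\in\delta^-_j}f_{ij}-\sum_{(j,i)\in\delta^+_j}f_{ji}=1$ for all $j\in V$; (6) $f_{ij}+f_{ji}\le\beta x_{ij}$ for all $\{i,j\}\in E$; (7) $\alpha x_{ij}\le f_{ij}\le\beta x_{ij}$ for all $i\in\mathbb{A}$, $j\in V$. *)

(* Defs.v *)
From HB Require Import structures.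
From mathcomp Require Import all_boot all_order all_algebra.
From mathcomp Require Import reals.

Set Implicit Arguments.
Unset Strict Implicit.
Unset Printing Implicit Defensive.

Import Order.TTheory GRing.Theory Num.Theory.
Local Open Scope ring_scope.

Record min_model (R : realType) := MinModel {
  solution : Type;
  feasible : solution -> Prop;
  objective : solution -> R
}.

Definition valid (R : realType) (M : min_model R)
    (P : solution M -> Prop) : Prop :=
  forall s : solution M, feasible s -> P s.

Definition binary (R : realType) (a : R) : Prop := a = 0 \/ a = 1.

Section Models.
Variables (R : realType) (n : nat).

(* The graph on the node set {1, .., n}, shifted to 'I_n, is given by its
   adjacency relation, assumed symmetric and irreflexive in the theorems.
   Quantities attached to an edge {i, j} are functions of the ordered pair
   (i, j), constrained to be symmetric; their values outside the edge set are
   unconstrained and never used. *)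
Variables (E : rel 'I_n) (d : 'I_n -> 'I_n -> R) (k alpha : nat).

Definition nonedge : rel 'I_n := fun i j => (i != j) && ~~ E i j.

(* Each edge {i, j} is counted once, as the pair with i < j. *)
Definition edge_sum (F : 'I_n -> 'I_n -> R) : R :=
  \sum_(i < n) \sum_(j < n | (i < j)%N && E i j) F i j.

(* [f1 s l c i j] is the flow of commodity (l, c) on the arc (i, j). *)
Record sol1 := Sol1 {
  y1 : 'I_n -> 'I_k -> R;
  x1 : 'I_k -> 'I_n -> 'I_n -> R;
  xbar1 : 'I_k -> 'I_n -> 'I_n -> R;
  f1 : 'I_n -> 'I_k -> 'I_n -> 'I_n -> R
}.

Record feasible1 (s : sol1) : Prop := Feasible1 {
  y1_binary : forall i c, binary (y1 s i c);
  x1_binary : forall c i j, E i j -> binary (x1 s c i j);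
  x1_sym : forall c i j, E i j -> x1 s c i j = x1 s c j i;
  xbar1_binary : forall c i j, nonedge i j -> binary (xbar1 s c i j);
  xbar1_sym : forall c i j, nonedge i j -> xbar1 s c i j = xbar1 s c j i;
  f1_ge0 : forall l c i j, E i j -> 0 <= f1 s l c i j;
  m1_assign : forall i, \sum_(c < k) y1 s i c = 1;
  m1_edge_lower : forall c i j, E i j ->
    y1 s i c + y1 s j c - x1 s c i j <= 1;
  m1_edge_upper : forall c i j, E i j ->
    0 <= y1 s i c + y1 s j c - 2 * x1 s c i j;
  m1_nonedge_lower : forall c i j, nonedge i j ->
    y1 s i c + y1 s j c - xbar1 s c i j <= 1;
  m1_nonedge_upper : forall c i j, nonedge i j ->
    0 <= y1 s i c + y1 s j c - 2 * xbar1 s c i j;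
  m1_capacity : forall c i j, E i j ->
    \sum_(l < n) (f1 s l c i j + f1 s l c j i)
      <= 2 * n%:R * k%:R * x1 s c i j;
  m1_flow : forall (l j : 'I_n) (c : 'I_k),
    \sum_(i < n | E i j) f1 s l c i j - \sum_(i < n | E j i) f1 s l c j i =
      if j == l then - \sum_(i < n | nonedge j i) xbar1 s c j i
      else if E l j then 0
      else xbar1 s c l j;
  m1_size : forall c, alpha%:R <= \sum_(i < n) y1 s i c
}.

Definition model1 : min_model R :=
  MinModel feasible1
    (fun s => \sum_(c < k) edge_sum (fun i j => d i j * x1 s c i j)).

(* Nodes of the extended graph: [inl i] is the original node i, and [inr c]
   is the artificial node n + c when [k] is numbered from 1. *)
Definition Ek : rel ('I_n + 'I_k)%type := fun u v =>
  match u, v with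
  | inl i, inl j => E i j
  | inr _, inr _ => false
  | _, _ => true
  end.

(* Real subtraction: beta may be negative. *)
Definition beta : R := n%:R - (k%:R - 1) * alpha%:R.

Record sol2 := Sol2 {
  y2 : 'I_n -> 'I_k -> R;
  x2 : 'I_n + 'I_k -> 'I_n + 'I_k -> R;
  f2 : 'I_n + 'I_k -> 'I_n + 'I_k -> R
}.

Record feasible2 (s : sol2) : Prop := Feasible2 {
  y2_binary : forall i c, binary (y2 s i c);
  x2_binary : forall u v, Ek u v -> binary (x2 s u v);
  x2_sym : forall u v, Ek u v -> x2 s u v = x2 s v u;
  f2_ge0 : forall u v, Ek u v -> 0 <= f2 s u v;
  m2_assign : forall i, \sum_(c < k) y2 s i c = 1;
  m2_same : forall c i j, E i j ->
    y2 s i c + y2 s j c - x2 s (inl i) (inl j) <= 1;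
  m2_diff : forall (c l : 'I_k) i j, c != l -> E i j ->
    y2 s i c + y2 s j l + x2 s (inl i) (inl j) <= 2;
  m2_root : forall a : 'I_k, \sum_(j < n) x2 s (inr a) (inl j) = 1;
  m2_supply : forall a : 'I_k,
    \sum_(j < n) f2 s (inr a) (inl j) = \sum_(j < n) y2 s j a;
  m2_flow : forall j : 'I_n,
    \sum_(u : 'I_n + 'I_k | Ek u (inl j)) f2 s u (inl j)
      - \sum_(u : 'I_n + 'I_k | Ek (inl j) u) f2 s (inl j) u = 1;
  m2_capacity : forall i j, E i j ->
    f2 s (inl i) (inl j) + f2 s (inl j) (inl i)
      <= beta * x2 s (inl i) (inl j);
  m2_root_lower : forall (a : 'I_k) (j : 'I_n),
    alpha%:R * x2 s (inr a) (inl j) <= f2 s (inr a) (inl j);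
  m2_root_upper : forall (a : 'I_k) (j : 'I_n),
    f2 s (inr a) (inl j) <= beta * x2 s (inr a) (inl j)
}.

Definition model2 : min_model R :=
  MinModel feasible2
    (fun s => edge_sum (fun i j => d i j * x2 s (inl i) (inl j))).

End Models.

(* Main.v *)
Require Import Defs.
From HB Require Import structures.
From mathcomp Require Import all_boot all_order all_algebra.
From mathcomp Require Import reals lra.

Set Implicit Arguments.
Unset Strict Implicit.
Unset Printing Implicit Defensive.

Import Order.TTheory GRing.Theory Num.Theory.
Local Open Scope ring_scope.

(** A graph on [n] nodes with at most [k] connected components has at least
    [n - k] edges, because every node other than the root of its component owns
    the edge to its parent in a shortest-path forest. In both models the edges
    selected by [x] form such a graph: flow conservation summed over a component
    [S] of the selected graph leaves no flow on the arcs between [S] and its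
    complement. In the second model some artificial node must therefore feed
    [S], and each of them feeds a single node. In the first model, if [S] missed
    a node [l] of its own cluster, then [S] would consume [#|S| > 0] units of
    commodity [l] and receive none, so clusters are connected. *)

(** * Counting edges through a shortest-path forest *)

Section Forest.
Variables (T : finType) (e : rel T).
Hypothesis e_sym : symmetric e.

(** Paths of length [m] are taken as tuples so that the predicate on [m] is boolean, as [ex_minn]
    requires. *)
Lemma shortest_path_to_root (v : T) :
  exists m, [exists p : m.-tuple T,
    path e v p && (last v p == fingraph.root e v)].
Proof.
have /connectP[p ep ->] := connect_root e v.
by exists (size p); apply/existsP; exists (in_tuple p); rewrite ep eqxx.
Qed.

Definition root_dist (v : T) : nat := ex_minn (shortest_path_to_root v).

(** Take the first step of a shortest path to the root: adjacent nodes share their root, so the tail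
    is a shorter path to it. *)
Lemma closer_neighbor (v : T) : fingraph.root e v != v ->
  exists u, e v u && (root_dist u < root_dist v)%N.
Proof.
move=> rv; rewrite /root_dist; case: ex_minnP => m /existsP[[p /= /eqP <-]].
case: p => [|u p] /=; first by rewrite eq_sym (negPf rv).
case/andP=> /andP[evu ep] /eqP lastp _; exists u; rewrite evu /=.
case: ex_minnP => m' _; apply; apply/existsP; exists (in_tuple p).
rewrite ep /= lastp; apply/eqP/fingraph.rootP; first exact: sym_connect_sym.
exact: connect1.
Qed.

End Forest.

(** The labelling [g] bounds the number of components: two roots with equal labels are connected,
    hence equal. The remaining nodes inject into the edges. *)
Lemma leq_nodes_edges (n k : nat) (e : rel 'I_n) (g : 'I_n -> 'I_k) :
  symmetric e -> (forall i j, g i = g j -> connect e i j) ->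
  (n <= k + #|[set p : 'I_n * 'I_n | (p.1 < p.2)%N && e p.1 p.2]|)%N.
Proof.
move=> e_sym g_conn.
pose A := [set v | fingraph.root e v == v].
have leA : (#|A| <= k)%N.
  rewrite -[k in leqRHS]card_ord; apply: (@leq_card_in _ _ g) => i j.
  rewrite !inE => /eqP ri /eqP rj /g_conn.
  by move/(fingraph.rootP (sym_connect_sym e_sym)); rewrite ri rj.
(* The default [v] never occurs off the roots, the only place where [par] matters. *)
pose par v := odflt v [pick u | e v u && (root_dist e u < root_dist e v)%N].
have parP v : v \in ~: A ->
    e v (par v) && (root_dist e (par v) < root_dist e v)%N.
  rewrite !inE => /(closer_neighbor e_sym)[u Hu].
  by rewrite /par; case: pickP => [//|/(_ u)]; rewrite Hu.
pose edge (v : 'I_n) := if (v < par v)%N then (v, par v) else (par v, v).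
rewrite -[n in leqLHS]card_ord -(cardsC A) leq_add //.
(* If two distinct nodes owned the same edge, each would be the parent of the other, and each would
   be strictly closer to the root. *)
have edge_inj : {in ~: A &, injective edge}.
  move=> v w /parP/andP[_ dv] /parP/andP[_ dw]; rewrite /edge.
  case: ifP => _; case: ifP => _ [].
  - by [].
  - by move=> Ev Ew; move: dw; rewrite -Ev -Ew ltnNge ltnW.
  - by move=> Ew Ev; move: dw; rewrite -Ev -Ew ltnNge ltnW.
  - by [].
rewrite -(card_in_imset edge_inj); apply: subset_leq_card.
apply/subsetP => _ /imsetP[v /parP/andP[ev dv] ->]; rewrite inE /edge.
have [//= |] := ltnP v (par v); first by rewrite ev andbT.
rewrite leq_eqVlt => /orP[/eqP/val_inj Ev|->]; last by rewrite /= e_sym.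
by move: dv; rewrite Ev ltnn.
Qed.

(** Common reduction for both models: [F] dominates the indicator of [e] edge by edge, so its sum
    dominates the edge count. *)
Lemma ler_sub_edge_sum (R : realType) (n k : nat) (E e : rel 'I_n)
    (g : 'I_n -> 'I_k) (F : 'I_n -> 'I_n -> R) :
  symmetric e -> subrel e E -> (forall i j, g i = g j -> connect e i j) ->
  (forall i j, E i j -> (e i j)%:R <= F i j) ->
  n%:R - k%:R <= edge_sum E F.
Proof.
move=> e_sym eE g_conn leF; rewrite lerBlDl.
have := leq_nodes_edges e_sym g_conn; rewrite -(ler_nat R) natrD.
move/le_trans; apply; rewrite lerD2l -sum1_card natr_sum.
rewrite big_mkcond /= /edge_sum pair_big_dep /= [leRHS]big_mkcond /=.
apply: ler_sum => -[i j] _; rewrite inE /=.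
case: (i < j)%N => //=; case Eij: (E i j).
  by have := leF _ _ Eij; case: (e i j).
by case eij: (e i j) => //; rewrite (eE _ _ eij) in Eij.
Qed.

(** An arc inside [S] is counted once as entering and once as leaving, so it cancels; arcs across
    the boundary contribute zero. *)
Lemma closed_flow_eq0 (V : zmodType) (T : finType) (E : rel T)
    (f : T -> T -> V) (S : {set T}) :
  (forall i j, E i j -> (i \in S) != (j \in S) -> f i j = 0) ->
  \sum_(j in S) (\sum_(i | E i j) f i j - \sum_(i | E j i) f j i) = 0.
Proof.
move=> f0; rewrite sumrB.
have restrict (P : pred T) (h : T -> V) :
    (forall i, P i -> i \notin S -> h i = 0) ->
    \sum_(i | P i) h i = \sum_(i in S) if P i then h i else 0.
  move=> h0; rewrite big_mkcond [RHS]big_mkcond /=; apply: eq_bigr => i _.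
  by case: ifP => [/h0|_]; case: ifP => // /negbT iS; apply.
apply/eqP; rewrite subr_eq0; apply/eqP.
transitivity (\sum_(j in S) \sum_(i in S) if E i j then f i j else 0).
  apply: eq_bigr => j jS; apply: restrict => i Eij iS.
  by apply: f0 => //; rewrite jS (negPf iS).
rewrite exchange_big; apply: eq_bigr => j jS /=; symmetry.
apply: restrict => i Eji iS.
by apply: f0 => //; rewrite jS (negPf iS).
Qed.

Lemma binary_ge0 (R : realType) (a : R) : binary a -> 0 <= a.
Proof. by case=> ->. Qed.

Lemma binary_sum1 (R : realType) (T : finType) (h : T -> R) :
  (forall i, binary (h i)) -> \sum_i h i = 1 ->
  exists2 i, h i = 1 & forall j, h j = 1 -> j = i.
Proof.
move=> hb sumh; case: (pickP (fun i => h i == 1)) => [i /eqP hi|h0].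
  exists i => // j hj; apply/eqP/negPn/negP => ji.
  move: sumh; rewrite (bigD1 i) //= (bigD1 j) //= hi hj => sumh.
  have : 0 <= \sum_(l | (l != i) && (l != j)) h l.
    by apply: sumr_ge0 => l _; exact: binary_ge0.
  by lra.
move: sumh; rewrite big1 => [|i _].
  by move/eqP; rewrite eq_sym oner_eq0.
by case: (hb i) => // /eqP; rewrite h0.
Qed.

Section Validity.
Variables (R : realType) (n : nat) (E : rel 'I_n) (k alpha : nat).
Hypothesis E_sym : symmetric E.

(** * First model: clusters are connected *)

Section Model1.
Variable s : sol1 R n k.
Hypothesis fs : feasible1 E alpha s.

(** Stated as a boolean predicate so that [xchoose] can extract the cluster. *)
Lemma cluster_exists i :
  exists c, (y1 s i c == 1) && [forall b, (y1 s i b == 1) ==> (b == c)].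
Proof.
have [c yc cU] := binary_sum1 (y1_binary fs i) (m1_assign fs i).
exists c; rewrite yc eqxx; apply/forallP => b.
by apply/implyP => /eqP/cU ->.
Qed.

Definition cluster (i : 'I_n) : 'I_k := xchoose (cluster_exists i).

Lemma y1_cluster i c : y1 s i c = (cluster i == c)%:R.
Proof.
have /andP[/eqP yc /forallP cU] := xchooseP (cluster_exists i).
have [<-//|ne] := eqVneq (cluster i) c.
case: (y1_binary fs i c) => // yc1.
by have := cU c; rewrite yc1 eqxx /= => /eqP Ec; rewrite Ec eqxx in ne.
Qed.

Definition cluster_edge : rel 'I_n :=
  fun i j => E i j && (cluster i == cluster j).

Lemma cluster_edge_sym : symmetric cluster_edge.
Proof. by move=> i j; rewrite /cluster_edge E_sym eq_sym. Qed.

Lemma cluster_edge_le i j : E i j ->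
  (cluster_edge i j)%:R <= \sum_(c < k) x1 s c i j.
Proof.
move=> Eij; have x_ge0 c : 0 <= x1 s c i j.
  exact/binary_ge0/(x1_binary fs).
rewrite /cluster_edge Eij /= (bigD1 (cluster i)) //=.
rewrite -[leLHS]addr0 lerD ?sumr_ge0 //.
case: eqP => //= Eg; have := m1_edge_lower fs (cluster i) Eij.
by rewrite !y1_cluster -Eg eqxx /=; lra.
Qed.

(** At most one end lies in cluster [c], so [2 * x1] is at most 1 and [x1] vanishes; the capacity
    then forces every commodity of [c] to zero. *)
Lemma f1_cut l c i j : E i j -> (cluster i != c) || (cluster j != c) ->
  f1 s l c i j = 0.
Proof.
move=> Eij ijc.
have x0 : x1 s c i j = 0.
  have := m1_edge_upper fs c Eij; rewrite !y1_cluster.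
  case: (x1_binary fs c Eij) => // ->.
  by case/orP: ijc => /negPf ->; case: eqP => _ /=; lra.
have f_ge0 m : 0 <= f1 s m c i j + f1 s m c j i.
  by rewrite addr_ge0 // (f1_ge0 fs) // E_sym.
have := m1_capacity fs c Eij; rewrite x0 mulr0 (bigD1 l) //=.
have : 0 <= \sum_(m < n | m != l) (f1 s m c i j + f1 s m c j i).
  by apply: sumr_ge0.
have := f1_ge0 fs l c Eij; have := f1_ge0 fs l c (etrans (E_sym j i) Eij).
lra.
Qed.

Lemma cluster_connected i l :
  cluster i = cluster l -> connect cluster_edge i l.
Proof.
move=> Eil; apply/negPn/negP => nil.
pose S := [set j | connect cluster_edge i j].
have cS j : j \in S -> cluster j = cluster l.
  rewrite inE => /connectP[p]; elim/last_ind: p j => [|p x IH] j /=.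
    by move=> _ ->.
  rewrite rcons_path last_rcons => /andP[/IH/(_ erefl) IHx] + ->.
  by case/andP=> _ /eqP <-.
have step j m : E j m -> j \in S -> cluster m = cluster l -> m \in S.
  move=> Ejm jS cm; move: (jS); rewrite !inE => /connect_trans; apply.
  by apply: connect1; rewrite /cluster_edge Ejm cm (cS j jS) eqxx.
(* By [step], an edge leaving [S] has an end outside the cluster of [l]. *)
have f0 j m : E j m -> (j \in S) != (m \in S) ->
    f1 s l (cluster l) j m = 0.
  move=> Ejm; case jS: (j \in S); case mS: (m \in S) => //= _;
    apply: f1_cut => //; apply/orP.
    right; apply/negP => /eqP cm.
    by rewrite (step _ _ Ejm jS cm) in mS.
  left; apply/negP => /eqP cj; rewrite E_sym in Ejm.
  by rewrite (step _ _ Ejm mS cj) in jS.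
have := closed_flow_eq0 f0.
(* Each node of [S] demands one unit: it differs from [l], is not adjacent to it by [step], and
   shares its cluster, so [xbar1] is 1. Hence [S] would be empty, yet it contains [i]. *)
rewrite (eq_bigr (fun=> 1)) => [|j jS].
  rewrite sumr_const => /eqP; rewrite pnatr_eq0 => /eqP/cards0_eq/setP/(_ i).
  by rewrite !inE connect0.
have lS : l \notin S by rewrite inE.
have nEjl : ~~ E l j.
  by apply: contra lS => Elj; apply: (step j) => //; rewrite E_sym.
have jl : j != l by apply: contraNneq lS => <-.
rewrite (m1_flow fs) (negPf jl) (negPf nEjl).
have nlj : nonedge E l j by rewrite /nonedge nEjl eq_sym jl.
have := m1_nonedge_lower fs (cluster l) nlj.
rewrite !y1_cluster (cS j jS) eqxx /=.
by case: (xbar1_binary fs (cluster l) nlj) => ->; lra.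
Qed.

Lemma model1_edges_ge :
  n%:R - k%:R <= \sum_(c < k) edge_sum E (fun i j => x1 s c i j).
Proof.
have -> : \sum_(c < k) edge_sum E (fun i j => x1 s c i j) =
    edge_sum E (fun i j => \sum_(c < k) x1 s c i j).
  rewrite /edge_sum exchange_big /=; apply: eq_bigr => i _.
  exact: exchange_big.
apply: (@ler_sub_edge_sum _ _ _ _ cluster_edge cluster).
- exact: cluster_edge_sym.
- by move=> i j /andP[].
- exact: cluster_connected.
- exact: cluster_edge_le.
Qed.

End Model1.

(** * Second model: each component is fed by an artificial node *)

Section Model2.
Variable s : sol2 R n k.
Hypothesis fs : feasible2 E alpha s.

Definition selected : rel 'I_n :=
  fun i j => E i j && (x2 s (inl i) (inl j) == 1).

Lemma selected_sym : symmetric selected.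
Proof.
move=> i j; rewrite /selected (E_sym i); case Eji: (E j i) => //=.
by rewrite (x2_sym fs (u := inl j)).
Qed.

Lemma f2_cut i j : E i j -> ~~ selected i j -> f2 s (inl i) (inl j) = 0.
Proof.
move=> Eij; rewrite /selected Eij /=.
have := m2_capacity fs Eij.
have := f2_ge0 fs (u := inl i) (v := inl j) Eij.
have := f2_ge0 fs (u := inl j) (v := inl i) (etrans (E_sym j i) Eij).
case: (x2_binary fs (u := inl i) (v := inl j) Eij) => ->; rewrite ?eqxx //.
by rewrite mulr0; lra.
Qed.

(** Otherwise the upper bounds on root arcs let nothing enter the component, while each of its nodes
    absorbs one unit. *)
Lemma component_fed i : exists a : 'I_k,
  [exists j, connect selected i j && (x2 s (inr a) (inl j) == 1)].
Proof.
case: (pickP (fun a : 'I_k =>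
    [exists j, connect selected i j && (x2 s (inr a) (inl j) == 1)])) => [a|none].
  by exists a.
pose S := [set j | connect selected i j].
have step j m : selected j m -> j \in S -> m \in S.
  by move=> /connect1 jm; rewrite !inE => /connect_trans; apply.
have f0 j m : E j m -> (j \in S) != (m \in S) -> f2 s (inl j) (inl m) = 0.
  move=> Ejm jmS; apply: f2_cut => //; apply: contra jmS => sel.
  apply/eqP; apply/idP/idP; apply: step => //; by rewrite selected_sym.
have fed0 j (a : 'I_k) : j \in S -> f2 s (inr a) (inl j) <= 0.
  rewrite inE => ij; have := m2_root_upper fs a j.
  case: (x2_binary fs (u := inr a) (v := inl j) isT) => xE.
    by rewrite xE mulr0.
  by have /existsP[] := none a; exists j; rewrite ij xE eqxx.
(* Dropping the arcs to and from artificial nodes can only raise the net inflow of a node of [S],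
   which was 1. *)
have : \sum_(j in S) (1 : R) <= 0.
  rewrite -[leRHS](closed_flow_eq0 f0); apply: ler_sum => j jS.
  rewrite -(m2_flow fs j) !big_sumType /= lerB //.
    by rewrite gerDl sumr_le0 // => a _; exact: fed0.
  by rewrite lerDl sumr_ge0 // => a _; exact: (f2_ge0 fs).
rewrite sumr_const lern0 => /eqP/cards0_eq/setP/(_ i).
by rewrite !inE connect0.
Qed.

Lemma model2_edges_ge :
  n%:R - k%:R <= edge_sum E (fun i j => x2 s (inl i) (inl j)).
Proof.
apply: (@ler_sub_edge_sum _ _ _ _ selected
  (fun i => xchoose (component_fed i))).
- exact: selected_sym.
- by move=> i j /andP[].
- move=> i j.
  have /existsP[u /andP[iu /eqP xu]] := xchooseP (component_fed i).
  have /existsP[v /andP[jv /eqP xv]] := xchooseP (component_fed j).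
  move=> Eij; rewrite -Eij in xv; set a := xchoose _ in xu xv.
  (* The artificial node [a] is attached to a single node [w], so [u] and [v] both equal [w], which
     links [i] to [j]. *)
  have [w _ wU] := binary_sum1
    (fun l => x2_binary fs (u := inr a) (v := inl l) isT) (m2_root fs a).
  rewrite (wU _ xu) in iu; rewrite (wU _ xv) in jv.
  apply: connect_trans iu _.
  by rewrite (sym_connect_sym selected_sym).
- move=> i j Eij; rewrite /selected Eij /=.
  by case: (x2_binary fs (u := inl i) (v := inl j) Eij) => ->;
    rewrite ?eqxx // eq_sym oner_eq0.
Qed.

End Model2.
End Validity.

Theorem theorem9 (R : realType) (n : nat) (E : rel 'I_n)
    (E_sym : symmetric E) (E_irr : irreflexive E)
    (d : 'I_n -> 'I_n -> R)
    (d_sym : forall i j, E i j -> d i j = d j i)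
    (d_ge0 : forall i j, E i j -> 0 <= d i j)
    (k alpha : nat) (k_ge2 : (2 <= k)%N) (alpha_ge2 : (2 <= alpha)%N) :
  valid (M := model1 E d k alpha)
    (fun s : sol1 R n k =>
       \sum_(c < k) edge_sum E (fun i j => x1 s c i j) >= n%:R - k%:R)
  /\
  valid (M := model2 E d k alpha)
    (fun s : sol2 R n k =>
       edge_sum E (fun i j => x2 s (inl i) (inl j)) >= n%:R - k%:R).
Proof.
split=> s fs; first exact: (model1_edges_ge E_sym fs).
exact: (model2_edges_ge E_sym fs).
Qed.
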